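(* Let $C$ be a locally finite simplicial complex that is $\mathrm{CAT}(0)$ with a polyhedral metric (having only finitely many isometry classes of cells and making $|C|$ a complete geodesic metric space) for which all vertex stars are convex. Then $C$ is arborescent.
   Context: Polyhedral metric: a $\mathrm{CAT}(\kappa)$ metric on a simplicial (or polytopal) complex is polyhedral if every cell, with the induced metric, is isometric to the convex hull of a finite set of points in the simply connected space form of constant curvature $\kappa$ (for $\kappa=0$, Euclidean space). For a face $\sigma$ of $C$, the star $\mathrm{st}(\sigma,C)$ is the minimal subcomplex of $C$ containing all faces of $C$ that contain $\sigma$. Convexity of vertex stars means: for each vertex $v$ of $C$, the geodesic segment in $|C|$ between any two points of $\mathrm{st}(v,C)$ lies in $\mathrm{st}(v,C)$. Collapses: a face $\sigma$ of a polytopal complex is free if it is strictly contained in only one other face. An elementary collapse is the deletion of a free face $\sigma$ (together with the unique face strictly containing it). A complex $K$ collapses to a subcomplex $K'$ if $K$ can be reduced to $K'$ by a finite (possibly empty) sequence of elementary collapses. The inverse of an elementary collapse is called a dilatation. Arborescent: a locally finite complex $C$ is arborescent if it is obtained from a vertex by a (possibly infinite) sequence of dilatations; equivalently, $C$ is the ascending union of finite subcomplexes $K_0\subseteq K_1\subseteq K_2\subseteq\cdots$ with $K_0$ a single vertex and $K_{i+1}$ collapsing onto $K_i$ for every $i$. *)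

(* Defs.v *)
From Stdlib Require Export Relations.
From HB Require Import structures.
From mathcomp Require Export all_boot all_order all_algebra finmap.
From mathcomp Require Export all_classical all_reals all_analysis.
Import Order.TTheory GRing.Theory Num.Theory.

Set Implicit Arguments.
Unset Strict Implicit.
Unset Printing Implicit Defensive.

Local Open Scope classical_set_scope.
Local Open Scope ring_scope.

Section Complexes.
Variable V : choiceType.

(* Faces are nonempty finite vertex sets: the empty set is not a face. An
   element v of V is a vertex of K only when [fset v] is in K. *)
Definition simplicial_complex (K : set {fset V}) : Prop :=
  (forall s, K s -> s != fset0) /\
  (forall s t : {fset V}, K s -> (t `<=` s)%fset -> t != fset0 -> K t).

Definition locally_finite (K : set {fset V}) : Prop :=
  forall v : V, finite_set [set s | K s /\ v \in s].

Definition star (s : {fset V}) (K : set {fset V}) : set {fset V} :=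
  smallest simplicial_complex [set t | K t /\ (s `<=` t)%fset].

(* s is a free face of K, and t is the only face of K strictly containing s. *)
Definition free_face (K : set {fset V}) (s t : {fset V}) : Prop :=
  [/\ K s, K t, (s `<` t)%fset & forall u, K u -> (s `<` u)%fset -> u = t].

Definition elementary_collapse (K K' : set {fset V}) : Prop :=
  exists s t, free_face K s t /\ K' = K `\` [set s; t].

Definition collapses : set {fset V} -> set {fset V} -> Prop :=
  clos_refl_trans _ elementary_collapse.

(* The sequence L may be eventually constant, which covers finite sequences of
   dilatations. *)
Definition arborescent (K : set {fset V}) : Prop :=
  exists L : nat -> set {fset V},
    [/\ forall i, [/\ simplicial_complex (L i), finite_set (L i) & L i `<=` K],
        (exists v : V, L 0%N = [set [fset v]%fset]),
        forall i, L i `<=` L i.+1 /\ collapses (L i.+1) (L i)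
      & \bigcup_i L i = K].

End Complexes.

Section Realization.
Variables (R : realType) (V : choiceType).

(* Points are given by their barycentric coordinates, extended by 0. *)
Definition cell (s : {fset V}) : set (V -> R) :=
  [set x | [/\ forall v, 0 <= x v, forall v, v \notin s -> x v = 0
             & \sum_(v <- s) x v = 1]].

Definition realization (K : set {fset V}) : set (V -> R) :=
  \bigcup_(s in K) cell s.

(* Open sets of the coherent (weak) topology of |K|: those meeting each closed
   cell in a relatively open set, the topology of a cell being the one of
   R^(#|` s|). *)
Definition realization_open (K : set {fset V}) (U : set (V -> R)) : Prop :=
  forall s, K s -> forall x, cell s x -> U x ->
    exists2 e : R, 0 < e &
      forall y, cell s y -> (forall v, `|x v - y v| < e) -> U y.

(* h identifies |K| with X, the topology of |K| being the one of the metric of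
   X. Only the values of h on |K| matter. *)
Definition realization_homeo (K : set {fset V}) (X : topologicalType)
    (h : (V -> R) -> X) : Prop :=
  set_bij (realization K) [set: X] h /\
  forall U : set X, open U <-> realization_open K (h @^-1` U).

End Realization.

Section Metric.
Variable R : realType.

(* The norm of the library on row vectors is the sup norm, hence this. *)
Definition eucl_dist n (x y : 'rV[R]_n) : R :=
  Num.sqrt (\sum_i (x ord0 i - y ord0 i) ^+ 2).

Definition convex_hull m n (p : 'I_m -> 'rV[R]_n) : set 'rV[R]_n :=
  [set x | exists a : 'I_m -> R,
     [/\ forall i, 0 <= a i, \sum_i a i = 1 & x = \sum_i a i *: p i]].

(* Injectivity of f follows when dX and dY are distances. *)
Definition isometric (X Y : Type) (dX : X -> X -> R) (A : set X)
    (dY : Y -> Y -> R) (B : set Y) : Prop :=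
  exists f : X -> Y, f @` A = B /\
    forall x y, A x -> A y -> dY (f x) (f y) = dX x y.

Variable X : metricType R.

Definition complete_space : Prop :=
  forall F : set_system X, ProperFilter F -> cauchy F -> exists l : X, F --> l.

(* Geodesics are parametrized proportionally to arc length on [0, 1]. *)
Definition geodesic (x y : X) (g : R -> X) : Prop :=
  [/\ g 0 = x, g 1 = y
    & forall s t, 0 <= s <= 1 -> 0 <= t <= 1 ->
        mdist (g s) (g t) = `|s - t| * mdist x y].

Definition geodesic_space : Prop := forall x y, exists g, geodesic x y g.

Definition geodesically_convex (A : set X) : Prop :=
  forall x y g, A x -> A y -> geodesic x y g ->
    forall t, 0 <= t <= 1 -> A (g t).

(* Two points on distinct sides of a geodesic triangle lie on two sides issuing
   from a common vertex, named x here; for two points on the same side the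
   comparison inequality is an equality. *)
Definition CAT0 : Prop :=
  geodesic_space /\
  forall (x y z : X) (g g' : R -> X) (x' y' z' : 'rV[R]_2),
    geodesic x y g -> geodesic x z g' ->
    eucl_dist x' y' = mdist x y -> eucl_dist y' z' = mdist y z ->
    eucl_dist x' z' = mdist x z ->
    forall s t, 0 <= s <= 1 -> 0 <= t <= 1 ->
      mdist (g s) (g' t) <=
        eucl_dist (x' + s *: (y' - x')) (x' + t *: (z' - x')).

Variables (V : choiceType) (K : set {fset V}) (h : (V -> R) -> X).

Definition polyhedral : Prop :=
  forall s, K s -> exists m n (p : 'I_m -> 'rV[R]_n),
    isometric (@mdist R X) (h @` cell s) (@eucl_dist n) (convex_hull p).

Definition finitely_many_shapes : Prop :=
  exists F : set {fset V},
    [/\ finite_set F, F `<=` K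
      & forall s, K s -> exists2 t, F t &
          isometric (@mdist R X) (h @` cell s) (@mdist R X) (h @` cell t)].

Definition convex_vertex_stars : Prop :=
  forall v : V, K [fset v]%fset ->
    geodesically_convex (h @` realization (star [fset v]%fset K)).

End Metric.

(* Main.v *)
Require Import Defs.
From mathcomp Require Import ring lra.
Import Order.TTheory GRing.Theory Num.Theory.
Import numFieldNormedType.Exports.

(* Fix a vertex w. Berge's theorem on convex sets with a convex union shows that
   C is a flag complex, so the star of a face s is the intersection of the stars
   of its vertices, hence compact and convex, and has a unique point x_s nearest
   to w. Let y_s be a vertex of the carrier of x_s. Toggling y_s in s does not
   change x: y_s |` s has x_s in its star and a smaller star than s, and if y_s
   lies in s then the stars of s and of s `\ y_s agree near x_s, where local
   minima of the distance to w are global. This matches all faces but {w}.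
   A face t of y_s |` s other than s either contains y_s or has x_t closer to w
   than x_s, so the pairs can be collapsed by decreasing distance from x_s to w.
   Closed balls are compact (Hopf-Rinow), which makes the sublevel complexes
   finite. *)

Set Implicit Arguments.
Unset Strict Implicit.
Unset Printing Implicit Defensive.

Local Open Scope classical_set_scope.
Local Open Scope ring_scope.

(** * Collapsing along a matching *)

Section AcyclicMatching.
Variables (R : realType) (V : choiceType).
Variables (C : set {fset V}) (m : {fset V} -> R) (y : {fset V} -> V).
Variable v0 : V.

(** On [[fset y s]] the result is the empty set, which is not a face; by [only_critical] the only
    face concerned is [[fset v0]]. *)
Definition toggle (s : {fset V}) : {fset V} :=
  if y s \in s then (s `\ y s)%fset else (y s |` s)%fset.

(** In the application, [m s] is the distance from the base point to the star of the face [s], and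
    the pointer [y s] is a vertex of the carrier of the nearest point. *)
Hypothesis C_cplx : simplicial_complex C.
Hypothesis m_mono : forall s t, C t -> s != fset0 -> (s `<=` t)%fset ->
  m s <= m t /\ (m s = m t -> y s = y t).
Hypothesis add_pointer : forall s, C s ->
  C (y s |` s)%fset /\ m (y s |` s)%fset = m s.
Hypothesis del_pointer : forall s, C s -> y s \in s -> s != [fset y s]%fset ->
  m (s `\ y s)%fset = m s.
Hypothesis C_v0 : C [fset v0]%fset.
Hypothesis y_v0 : y [fset v0]%fset = v0.
Hypothesis only_critical : forall s, C s -> s = [fset y s]%fset ->
  s = [fset v0]%fset.

Let noncrit s : C s -> s != [fset v0]%fset -> s != [fset y s]%fset.
Proof. by move=> Cs; apply: contraNneq => /(only_critical Cs) ->. Qed.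

Let del_neq0 s : y s \in s -> s != [fset y s]%fset -> (s `\ y s)%fset != fset0.
Proof.
move=> ys; apply: contraNneq => E.
by rewrite -[X in X == _](fsetD1K ys) E fsetU0.
Qed.

(** [s] and [toggle s] are nested with the same [m], so the equality case of [m_mono] gives them the
    same pointer; hence toggling twice restores [s]. *)
Lemma toggleP s : C s -> s != [fset v0]%fset ->
  [/\ C (toggle s), m (toggle s) = m s, y (toggle s) = y s,
      toggle (toggle s) = s & toggle s != [fset v0]%fset].
Proof.
move=> Cs sv; have sy := noncrit Cs sv; have [C0 Csub] := C_cplx.
have [ts_C tm ty tt] : [/\ C (toggle s), m (toggle s) = m s,
    y (toggle s) = y s & toggle (toggle s) = s].
  rewrite /toggle; case: ifPn => ys.
    have d0 := del_neq0 ys sy; have sub := fsubsetDl s [fset y s]%fset.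
    have dm := del_pointer Cs ys sy.
    have dy : y (s `\ y s)%fset = y s by apply: (m_mono Cs d0 sub).2.
    split=> //; first exact: Csub Cs sub d0.
    by rewrite dy !inE eqxx /= fsetD1K.
  have [Cu mu] := add_pointer Cs.
  have dy : y (y s |` s)%fset = y s.
    by apply/esym; apply: (m_mono Cu (C0 _ Cs) (fsubsetUr _ _)).2; rewrite mu.
  by split=> //; rewrite dy fset1U1 fsetU1K.
split=> //; apply/eqP => E.
have yv : y s = v0 by rewrite -ty E y_v0.
move: E; rewrite /toggle yv; case: ifP => [_ /fsetP/(_ v0)|vs E].
  by rewrite !inE eqxx.
have /fset0Pn[x xs] := C0 _ Cs.
have : x \in (v0 |` s)%fset by rewrite inE xs orbT.
by rewrite E inE => /eqP xv; rewrite -xv xs in vs.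
Qed.

Let subset_finite (A : set {fset V}) (P : {fset V} -> Prop) (f : {fset V} -> R) :
  finite_set A -> (exists2 s, A s & P s) ->
  exists s, [/\ A s, P s & forall t, A t -> P t -> f t <= f s].
Proof.
move=> finA [s0 As0 Ps0].
have fin : finite_set (A `&` [set s | P s]) by exact: sub_finite_set finA => s [].
have s0in : s0 \in fset_set (A `&` [set s | P s]) by rewrite in_fset_set // inE.
pose S := fset_set (A `&` [set s | P s]).
case: (arg_maxP (fun i : S => f (val i)) (isT : predT [` s0in]%fset)) => i _ maxi.
have := valP i; rewrite in_fset_set // inE => -[Ai Pi].
exists (val i); split=> // t At Pt.
have tin : t \in S by rewrite in_fset_set // inE.
exact: (maxi [` tin]%fset).
Qed.

(** Induction on a bound, since each collapse removes two faces. Among the faces outside [K'] that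
    have the largest [m] and omit their pointer, one of maximal cardinality is free, its only proper
    coface being its toggle. *)
Lemma collapse_matching n (K K' : set {fset V}) :
  simplicial_complex K' -> simplicial_complex K -> finite_set K ->
  K `<=` C -> K' `<=` K -> K' [fset v0]%fset ->
  (forall s, K s -> ~ K' s -> K (toggle s) /\ ~ K' (toggle s)) ->
  (#|` fset_set (K `\` K')| <= n)%N -> collapses K K'.
Proof.
move=> K'c; elim: n K => [|n IHn] K Kc finK KC K'K K'v tog.
  rewrite leqn0 cardfs_eq0 => /eqP E.
  have finD : finite_set (K `\` K') by exact: sub_finite_set finK => s [].
  suff -> : K = K' by exact: rt_refl.
  apply/seteqP; split=> // s Ks; apply: contrapT => nK's.
  by have /seteqP[/(_ s (conj Ks nK's))] := fset_set_set0 finD E.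
move=> cardK.
have finD : finite_set (K `\` K') by exact: sub_finite_set finK => s [].
have [D0|/set0P D0] := eqVneq (K `\` K') set0.
  by apply: (IHn K) => //; rewrite D0 fset_set0 cardfs0.
have [s1 [[Ks1 nKs1] _ max1]] : exists s, [/\ (K `\` K') s, True &
    forall t, (K `\` K') t -> True -> m t <= m s].
  by apply: subset_finite => //; case: D0 => s Ds; exists s.
have nv s : ~ K' s -> s != [fset v0]%fset by apply: contra_notN => /eqP ->.
have tP s : (K `\` K') s -> [/\ (K `\` K') (toggle s), m (toggle s) = m s,
    y (toggle s) = y s & toggle (toggle s) = s].
  move=> [Ks nKs]; have [? ? ? ? _] := toggleP (KC _ Ks) (nv _ nKs).
  by split=> //; have [] := tog _ Ks nKs.
have [s [[Ks nKs] [ys ms] maxs]] : exists s, [/\ (K `\` K') s,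
    (y s \notin s) /\ m s = m s1 &
    forall t, (K `\` K') t -> (y t \notin t) /\ m t = m s1 ->
       (#|` t|%:R : R) <= #|` s|%:R].
  apply: subset_finite => //.
  have [y1|y1] := boolP (y s1 \in s1); last by exists s1.
  have [D1 m1 yE _] := tP _ (conj Ks1 nKs1).
  exists (toggle s1) => //; split=> //.
  by rewrite yE /toggle y1 !inE eqxx.
have [[Kt nKt] mt yt tt] := tP _ (conj Ks nKs).
have st : toggle s = (y s |` s)%fset by rewrite /toggle (negPf ys).
have free : free_face K s (toggle s).
  split=> //; first by rewrite st; apply: fproperUr; rewrite fsub1set.
  move=> u Ku su.
  have s0 : s != fset0 by apply: Kc.1.
  have nKu : ~ K' u by apply: contra_not nKs => K'u; exact: K'c.2 K'u (fproper_sub su) s0.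
  have [le_su yE] := m_mono (KC _ Ku) s0 (fproper_sub su).
  have mu : m u = m s by apply/le_anti; rewrite le_su ms max1.
  have {}yE : y s = y u by apply: yE.
  (* Otherwise [u] would be a larger candidate in the choice of [s]. *)
  have yu : y u \in u.
    apply: contraT => yu.
    have := maxs _ (conj Ku nKu) (conj yu (etrans mu ms)).
    by rewrite ler_nat leqNgt fproper_ltn_card.
  have [[Ktu nKtu] mtu ytu _] := tP _ (conj Ku nKu).
  have tuE : toggle u = (u `\ y s)%fset by rewrite /toggle yu yE.
  have : (s `<=` toggle u)%fset.
    rewrite tuE; apply/fsubsetP => x xs; rewrite !inE (fsubsetP (fproper_sub su)) //.
    by rewrite andbT; apply: contraNneq ys => <-.
  (* Without its pointer [u] is again a candidate and still contains [s], so it equals [s] by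
     maximality of the cardinality. *)
  have := maxs _ (conj Ktu nKtu); rewrite mtu mu ms ytu -yE.
  have -> : y s \notin toggle u by rewrite tuE !inE eqxx.
  move=> /(_ (conj isT erefl)); rewrite ler_nat => le_c sub.
  have -> : s = toggle u by apply/eqP; rewrite eqEfcard sub.
  by have [_ _ _ ->] := tP _ (conj Ku nKu).
apply: rt_trans; first by apply: rt_step; exists s, (toggle s).
have sub : K `\` [set s; toggle s] `<=` K by move=> u [].
apply: IHn.
(* Since [s] is free, a face containing [s] or its toggle is one of the two. *)
- split=> [u [Ku _]|u t [Ku /not_orP[us ut]] tu t0]; first exact: Kc.1.
  have Kt' := Kc.2 _ _ Ku tu t0; split=> //; case=> /= E; subst.
  + case: (eqVneq u s) => [//|us']; apply: ut.
    case: free => _ _ _; apply=> //.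
    by rewrite fproperEneq tu eq_sym us'.
  + apply: ut; case: free => _ _ ss; apply=> //.
    exact: fproper_sub_trans ss tu.
- exact: sub_finite_set finK.
- by move=> u /sub/KC.
- by move=> u K'u; split; [exact: K'K|case=> E; [case: nKs|case: nKt]; rewrite -E].
- by [].
- move=> u [Ku /not_orP[us ut]] nKu.
  have [[Ktu nKtu] _ _ ttu] := tP _ (conj Ku nKu).
  split=> //; split=> //; case=> E.
    by apply: ut; rewrite -ttu E.
  by apply: us; rewrite -ttu E tt.
rewrite -ltnS; apply: leq_trans cardK; apply: fproper_ltn_card.
have finD' : finite_set ((K `\` [set s; toggle s]) `\` K').
  by apply: sub_finite_set finD => u [[]].
rewrite fproperEneq; apply/andP; split; last first.
  by rewrite -fset_set_sub // => u [[]].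
apply/eqP => /fsetP/(_ s); rewrite !in_fset_set // [RHS]mem_set // memNset //.
by case=> [[_ ns]] _; apply: ns; left.
Qed.

(** Monotonicity of [m] makes its sublevel sets subcomplexes, and [toggle] preserves [m], so the
    matching restricts to the difference of two consecutive ones. *)
Lemma arborescent_matching :
  (forall r : nat, finite_set [set s | C s /\ m s <= r%:R]) ->
  m [fset v0]%fset <= 0 ->
  arborescent C.
Proof.
move=> fin m0.
(* Indices are shifted by one: stage 0 is the vertex alone, stage [n.+1] the sublevel set at [n]. *)
pose L i := if i is n.+1 then [set s | C s /\ m s <= n%:R]
            else [set [fset v0]%fset].
have Lc i : simplicial_complex (L i).
  case: i => [|n]; split=> /=.
  - by move=> s ->; apply/fset0Pn; exists v0; rewrite inE.
  - move=> s t -> tv t0; apply/eqP; move: tv.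
    by rewrite fsubset1 (negPf t0) orbF.
  - by move=> s [/C_cplx.1].
  - move=> s t [Cs ms] ts t0; split; first exact: C_cplx.2 Cs ts t0.
    exact: le_trans (m_mono Cs t0 ts).1 ms.
have LC i : L i `<=` C by case: i => [s ->//|n s []].
have Lfin i : finite_set (L i) by case: i => [|n]; [exact: finite_set1|exact: fin].
have Lv i : L i [fset v0]%fset.
  by case: i => // n; split=> //; apply: le_trans m0 _.
have Lmono i : L i `<=` L i.+1.
  case: i => [s ->|n s [Cs ms]]; first exact: (Lv 1).
  by split=> //; apply: le_trans ms _; rewrite ler_nat.
exists L; split.
- by move=> i; split.
- by exists v0.
- move=> i; split=> //; apply: collapse_matching (leqnn _) => //.
  move=> s Ls nLs.
  have sv : s != [fset v0]%fset by apply: contra_notN nLs => /eqP ->.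
  have [Ct mt _ _ tv] := toggleP (LC _ _ Ls) sv.
  split; first by split=> //; rewrite mt; case: Ls.
  case: (i) nLs => [_|n nLs] /=; first exact/eqP.
  by rewrite mt => -[_ mn]; apply: nLs; split=> //; exact: LC Ls.
apply/seteqP; split=> [s [i _ /LC]//|s Cs].
(* One successor rounds [m s] up, the other is the shift in [L]. *)
exists (Num.truncn (m s)).+2 => //; split=> //.
by apply: ltW; apply: truncnS_gt.
Qed.

End AcyclicMatching.

(** * CAT(0) spaces *)

Section EuclideanDistance.
Variable R : realType.

Lemma sqr_eucl_dist n (x y : 'rV[R]_n) :
  eucl_dist x y ^+ 2 = \sum_i (x ord0 i - y ord0 i) ^+ 2.
Proof. by rewrite sqr_sqrtr // sumr_ge0 // => i _; exact: sqr_ge0. Qed.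

Lemma eucl_dist_line n (x y : 'rV[R]_n) s t :
  eucl_dist (x + s *: (y - x)) (x + t *: (y - x)) = `|s - t| * eucl_dist x y.
Proof.
rewrite /eucl_dist -sqrtr_sqr -sqrtrM ?sqr_ge0 // mulr_sumr.
by congr Num.sqrt; apply: eq_bigr => i _; rewrite !mxE; ring.
Qed.

Lemma stewart n (x y z : 'rV[R]_n) t :
  eucl_dist (x + t *: (y - x)) z ^+ 2 =
  (1 - t) * eucl_dist x z ^+ 2 + t * eucl_dist y z ^+ 2
    - t * (1 - t) * eucl_dist x y ^+ 2.
Proof.
rewrite !sqr_eucl_dist !mulr_sumr -big_split /=.
rewrite -sumrB; apply: eq_bigr => i _; rewrite !mxE; ring.
Qed.

Lemma comparison_triangle (a b c : R) : 0 <= a -> 0 <= b -> 0 <= c ->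
  a <= b + c -> b <= a + c -> c <= a + b ->
  exists x y z : 'rV[R]_2,
    [/\ eucl_dist x y = a, eucl_dist y z = b & eucl_dist x z = c].
Proof.
move=> a0 b0 c0 abc bac cab.
pose pt (u v : R) : 'rV[R]_2 := \row_i (if i == 0 then u else v).
have dE u v u' v' d : 0 <= d -> (u - u') ^+ 2 + (v - v') ^+ 2 = d ^+ 2 ->
    eucl_dist (pt u v) (pt u' v') = d.
  move=> d0 E; apply/eqP; rewrite -(@eqrXn2 _ 2) ?sqrtr_ge0 // sqr_eucl_dist.
  by rewrite !big_ord_recl big_ord0 !mxE /= addr0 E.
have [a_eq0|a_neq0] := eqVneq a 0.
  exists (pt 0 0), (pt 0 0), (pt c 0).
  by split; apply: dE => //; [rewrite a_eq0; ring|have -> : b = c by lra|]; ring.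
(* The law of cosines, with [x] at the origin and [y] on the first axis. *)
pose u := (a ^+ 2 + c ^+ 2 - b ^+ 2) / (2 * a).
have uE : 2 * a * u = a ^+ 2 + c ^+ 2 - b ^+ 2 by rewrite /u; field.
have pos : 0 < a by rewrite lt_neqAle eq_sym a_neq0.
have h0 : 0 <= c ^+ 2 - u ^+ 2.
  (* Heron's formula; the factors are nonnegative by the triangle inequalities. *)
  have -> : c ^+ 2 - u ^+ 2 = (a + b + c) * (a + c - b) * (b + c - a) * (a + b - c) / (4 * a ^+ 2).
    by rewrite /u; field.
  apply: divr_ge0; last by rewrite mulr_ge0 // sqr_ge0.
  by rewrite !mulr_ge0 //; lra.
exists (pt 0 0), (pt a 0), (pt u (Num.sqrt (c ^+ 2 - u ^+ 2))).
split; apply: dE => //.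
- ring.
- rewrite sub0r sqrrN sqr_sqrtr //.
  have -> : (a - u) ^+ 2 + (c ^+ 2 - u ^+ 2) = a ^+ 2 + c ^+ 2 - 2 * a * u by ring.
  by rewrite uE; ring.
- by rewrite !sub0r !sqrrN sqr_sqrtr //; ring.
Qed.

Lemma convex_hull_line m n (p : 'I_m -> 'rV[R]_n) x y t :
  convex_hull p x -> convex_hull p y -> 0 <= t <= 1 ->
  convex_hull p (x + t *: (y - x)).
Proof.
move=> [a [a0 a1 ->]] [b [b0 b1 ->]] /andP[t0 t1].
exists (fun i => (1 - t) * a i + t * b i); split.
- by move=> i; rewrite addr_ge0 // mulr_ge0 // subr_ge0.
- by rewrite big_split /= -!mulr_sumr a1 b1; ring.
- rewrite -sumrB scaler_sumr -big_split /=; apply: eq_bigr => i _.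
  rewrite -scalerBl scalerA -scalerDl; congr (_ *: _); ring.
Qed.

End EuclideanDistance.

(** * Consequences of the CAT(0) inequality, up to Berge's theorem *)

Section MetricSpace.
Variables (R : realType) (X : metricType R).
Implicit Types (a b w : X) (g : R -> X) (A Q : set X).

Lemma mdist_continuous w : continuous (fun p : X => mdist p w).
Proof.
move=> p; apply/cvgrPdist_lt => e e0; near=> q.
have pq : mdist p q < e.
  have : ball p e q by near: q; exact: nbhsx_ballx.
  by rewrite ballEmdist.
have := metric_triangle p q w; have := metric_triangle q p w.
rewrite (metric_sym q p) ltr_norml => ? ?; apply/andP; split; lra.
Unshelve. all: by end_near. Qed.

Lemma compact_mdist_min w A : A !=set0 -> compact A ->
  exists2 c, A c & forall p, A p -> mdist c w <= mdist p w.
Proof.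
move=> A0 cA; have [|c cA' minc] := compact_EVT_min A0 cA (f := fun p => mdist p w).
  by apply: continuous_subspaceT; exact: mdist_continuous.
by exists c; [exact: set_mem|move=> p Ap; exact/minc/mem_set].
Qed.

Lemma compact_mdist_min2 A B : A !=set0 -> B !=set0 -> compact A -> compact B ->
  exists a b, [/\ A a, B b & forall p q, A p -> B q -> mdist a b <= mdist p q].
Proof.
move=> [a0 Aa0] [b0 Bb0] cA cB.
have [|||[a b]] := @compact_EVT_min _ _ (fun u : X * X => mdist u.1 u.2) (A `*` B).
- by exists (a0, b0).
- exact: compact_setX.
- apply: continuous_subspaceT => -[p q]; apply/cvgrPdist_lt => e e0; near=> u.
  have [] : ball p (e / 2) u.1 /\ ball q (e / 2) u.2.
    near: u; exists (ball p (e / 2), ball q (e / 2)); last by case.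
    by split; apply: nbhsx_ballx; rewrite divr_gt0.
  rewrite !ballEmdist /= => pu qu.
  have := metric_triangle p u.1 q; have := metric_triangle u.1 u.2 q.
  have := metric_triangle u.1 p u.2; have := metric_triangle p q u.2.
  rewrite (metric_sym u.1 p) (metric_sym u.2 q) ltr_norml => ? ? ? ?.
  apply/andP; split; lra.
- rewrite inE => -[/= Aa Bb] minab; exists a, b; split=> // p q Ap Bq.
  by apply: (minab (p, q)); rewrite inE.
Unshelve. all: by end_near. Qed.

Lemma geodesic_near a b g (P : set X) : geodesic a b g -> nbhs a P ->
  exists2 t, 0 < t <= 1 & P (g t).
Proof.
move=> [g0 g1 gd] /nbhs_ballP[e /= e0 eP].
have d0 := mdist_ge0 a b.
(* The summand 1 covers the case [a = b] and makes [t * mdist a b < e] strict. *)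
pose t := Num.min 1 (e / (mdist a b + 1)).
have t0 : 0 < t by rewrite lt_min ltr01 divr_gt0 // ltr_wpDl.
have t1 : t <= 1 by rewrite ge_min lexx.
exists t; first by rewrite t0.
apply: eP; rewrite ballEmdist /= -[a in mdist a _]g0 gd ?lexx ?ler01 ?(ltW t0) //.
rewrite sub0r normrN gtr0_norm //.
apply: (@lt_le_trans _ _ (t * (mdist a b + 1))); first by rewrite ltr_pM2l // ltrDl.
by rewrite -ler_pdivlMr ?ge_min ?lexx ?orbT // ltr_wpDl.
Qed.

Hypothesis catX : CAT0 X.

(* The inequality of Bruhat and Tits: the CAT(0) inequality between a vertex
   and the points of the opposite side. *)
Lemma CN_inequality a b w g t : geodesic a b g -> 0 <= t <= 1 ->
  mdist (g t) w ^+ 2 <= (1 - t) * mdist a w ^+ 2 + t * mdist b w ^+ 2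
    - t * (1 - t) * mdist a b ^+ 2.
Proof.
move=> gg t01; have [geo cat] := catX; have [g' gg'] := geo a w.
have [||||||x [y [z [xy yz xz]]]] :=
  @comparison_triangle R (mdist a b) (mdist b w) (mdist a w).
- exact: mdist_ge0.
- exact: mdist_ge0.
- exact: mdist_ge0.
- by rewrite (metric_sym b w) addrC; exact: metric_triangle.
- by rewrite (metric_sym a b); exact: metric_triangle.
- exact: metric_triangle.
have := cat _ _ _ _ _ x y z gg gg' xy yz xz t 1 t01.
rewrite lexx ler01 scale1r [x + (z - x)]addrC subrK => /(_ isT).
have [_ -> _] := gg'; rewrite -xy -yz -xz => le_d.
by rewrite -stewart ler_pXn2r // nnegrE ?mdist_ge0 ?sqrtr_ge0.
Qed.

(** For [w] equal to [g' t], the right side of [CN_inequality] along [g] vanishes. *)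
Lemma geodesic_unique a b g g' t :
  geodesic a b g -> geodesic a b g' -> 0 <= t <= 1 -> g t = g' t.
Proof.
move=> gg [g'0 g'1 g'd] t01; have /andP[t0 t1] := t01.
set D := mdist a b in g'd *.
have da : mdist a (g' t) = t * D.
  by rewrite -[in LHS]g'0 g'd ?lexx ?ler01 // sub0r normrN ger0_norm.
have db : mdist b (g' t) = (1 - t) * D.
  by rewrite -[in LHS]g'1 g'd ?lexx ?ler01 // ger0_norm ?subr_ge0.
have := CN_inequality (g' t) gg t01; rewrite da db -/D.
have -> : (1 - t) * (t * D) ^+ 2 + t * ((1 - t) * D) ^+ 2 - t * (1 - t) * D ^+ 2 = 0 by ring.
move=> le0; apply/mdist_positivity/eqP.
by rewrite -sqrf_eq0; apply/eqP/le_anti; rewrite le0 sqr_ge0.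
Qed.

(** By [CN_inequality] the squared distance to [w] is convex along [g]. The decrease starts at once,
    which is what rules out local minima that are not global. *)
Lemma mdist_geodesic_lt a b w g t : geodesic a b g -> 0 < t <= 1 ->
  mdist b w < mdist a w -> mdist (g t) w < mdist a w.
Proof.
move=> gg /andP[t0 t1] lt_ba.
rewrite -(@ltr_pXn2r _ 2) // ?nnegrE ?mdist_ge0 //.
have t01 : 0 <= t <= 1 by rewrite ltW.
apply: le_lt_trans (CN_inequality w gg t01) _.
have lt2 : 0 < t * (mdist a w ^+ 2 - mdist b w ^+ 2).
  by rewrite mulr_gt0 // subr_gt0 ltr_pXn2r // nnegrE mdist_ge0.
have : 0 <= t * (1 - t) * mdist a b ^+ 2.
  by apply: mulr_ge0; [rewrite mulr_ge0 ?(ltW t0) ?subr_ge0|exact: sqr_ge0].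
lra.
Qed.

(** The midpoint of two distinct minimizers would be strictly closer to [w]. *)
Lemma mdist_min_unique A a b w : geodesically_convex A -> A a -> A b ->
  (forall p, A p -> mdist a w <= mdist p w) -> mdist b w = mdist a w -> a = b.
Proof.
move=> cA Aa Ab mina ba; have [geo _] := catX; have [g gg] := geo a b.
have t01 : 0 <= (2^-1 : R) <= 1 by apply/andP; split; lra.
have := CN_inequality w gg t01.
have : mdist a w ^+ 2 <= mdist (g 2^-1) w ^+ 2.
  by rewrite ler_pXn2r // ?nnegrE ?mdist_ge0 //; apply/mina/(cA _ _ _ Aa Ab gg).
rewrite ba => h1 h2; apply/mdist_positivity/eqP.
have := sqr_ge0 (mdist a b); rewrite -sqrf_eq0 => h3; apply/eqP; nra.
Qed.

(** What is kept of an isometry with a Euclidean convex set: convexity, and equality in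
    [CN_inequality] (Stewart's theorem). It makes the difference of the squared distances to two
    points of [Q] affine along geodesics. *)
Definition flat Q := forall a b g, Q a -> Q b -> geodesic a b g ->
  forall t, 0 <= t <= 1 -> Q (g t) /\ forall w, Q w ->
    mdist (g t) w ^+ 2 = (1 - t) * mdist a w ^+ 2 + t * mdist b w ^+ 2
      - t * (1 - t) * mdist a b ^+ 2.

(** Straight segments of the hull pull back to geodesics of [X] inside [Q]; by [geodesic_unique]
    there are no others between points of [Q]. *)
Lemma flat_polytope m n (p : 'I_m -> 'rV[R]_n) Q :
  isometric (@mdist R X) Q (@eucl_dist R n) (convex_hull p) -> flat Q.
Proof.
move=> [f [fQ fd]] a b g Qa Qb gg t t01.
have fP q : Q q -> convex_hull p (f q) by move=> Qq; rewrite -fQ; exists q.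
have /choice[k kP] : forall s, exists q, 0 <= s <= 1 ->
    Q q /\ f q = f a + s *: (f b - f a).
  move=> s; have [s01|ns] := boolP (0 <= s <= 1); last by exists a.
  have := convex_hull_line (fP _ Qa) (fP _ Qb) s01.
  by rewrite -fQ => -[q Qq fq]; exists q.
have inj q q' : Q q -> Q q' -> f q = f q' -> q = q'.
  move=> Qq Qq' E; apply: mdist_positivity; rewrite -fd // E.
  have := eucl_dist_line (f q') (f q') 0 0.
  by rewrite !scale0r !addr0 subrr normr0 mul0r.
have z01 : 0 <= (0 : R) <= 1 by rewrite lexx ler01.
have o01 : 0 <= (1 : R) <= 1 by rewrite lexx ler01.
have kg : geodesic a b k.
  split.
  - have [Q0 f0] := kP _ z01; apply: inj => //; by rewrite f0 scale0r addr0.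
  - have [Q1 f1] := kP _ o01; apply: inj => //; by rewrite f1 scale1r addrC subrK.
  move=> r s r01 s01; have [Qr fr] := kP _ r01; have [Qs fs] := kP _ s01.
  by rewrite -fd // fr fs eucl_dist_line fd.
rewrite (geodesic_unique gg kg t01); have [Qt ft] := kP _ t01.
by split=> // w Qw; rewrite -!fd // ft stewart.
Qed.

Lemma flat_convex Q : flat Q -> geodesically_convex Q.
Proof. by move=> fl a b g Qa Qb gg t t01; have [] := fl _ _ _ Qa Qb gg t t01. Qed.

(** The angle at the projection [a] is not acute. Minimality of [a] is written along the geodesic to
    [p] and divided by [t], and then [t] is taken small. *)
Lemma flat_projection Q A a b p : flat Q -> A `<=` Q -> geodesically_convex A ->
  A a -> Q b -> (forall q, A q -> mdist a b <= mdist q b) -> A p ->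
  mdist a b ^+ 2 + mdist a p ^+ 2 <= mdist p b ^+ 2.
Proof.
move=> fl AQ cA Aa Qb mina Ap; have [geo _] := catX; have [g gg] := geo a p.
have key t : 0 < t <= 1 -> mdist a b ^+ 2 + (1 - t) * mdist a p ^+ 2 <= mdist p b ^+ 2.
  move=> /andP[t0 t1]; have t01 : 0 <= t <= 1 by rewrite ltW.
  have [_ /(_ _ Qb)] := fl _ _ _ (AQ _ Aa) (AQ _ Ap) gg t t01.
  have : mdist a b ^+ 2 <= mdist (g t) b ^+ 2.
    rewrite ler_pXn2r // ?nnegrE ?mdist_ge0 //.
    exact/mina/(cA _ _ _ Aa Ap gg).
  move=> + E; rewrite E => le1; rewrite -(ler_pM2l t0); lra.
apply/ler_addgt0Pr => e e0.
pose t := Num.min 1 (e / (mdist a p ^+ 2 + 1)).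
have D0 := sqr_ge0 (mdist a p).
have t0 : 0 < t by rewrite lt_min ltr01 divr_gt0 // ltr_wpDl.
have t1 : t <= 1 by rewrite ge_min lexx.
have := key t; rewrite t0 t1 => /(_ isT).
have : t * (mdist a p ^+ 2 + 1) <= e.
  by rewrite -ler_pdivlMr ?ge_min ?lexx ?orbT // ltr_wpDl.
lra.
Qed.

(* Berge's theorem. If the last set misses the intersection of the others,
   the bisector of a shortest segment between the two cuts the other sets in a
   smaller configuration of the same kind. *)
Lemma compact_convex_bigcap_neq0 Q m (D : nat -> set X) : flat Q ->
  (forall i, (i <= m)%N -> [/\ compact (D i), geodesically_convex (D i) & D i `<=` Q]) ->
  geodesically_convex [set p | exists2 i, (i <= m)%N & D i p] ->
  (exists2 i, (i <= m)%N & D i !=set0) ->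
  (forall j, (j <= m)%N ->
     exists p, forall i, (i <= m)%N -> i != j -> D i p) ->
  exists p, forall i, (i <= m)%N -> D i p.
Proof.
move=> fl; elim: m D => [|m IHm] D DP Ucvx U0 Dj.
  by have [[|//] _ [p Dp]] := U0; exists p => -[].
apply: contrapT => noD.
pose A := D m.+1; pose B := [set p | forall i, (i <= m)%N -> D i p].
have [cA gA AQ] : [/\ compact A, geodesically_convex A & A `<=` Q] by exact: DP.
have BQ : B `<=` Q by move=> p /(_ 0%N isT); have [_ _] := DP 0%N isT; apply.
have cB : compact B.
  have BE : B = D 0%N `&` \bigcap_(i in [set i | (i <= m)%N]) D i.
    by apply/seteqP; split=> [p Bp|p [_ Bp]] //; split; [exact: Bp|].
  rewrite BE; apply: compact_closedI; first by have [] := DP 0%N isT.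
  apply: closed_bigI => i /= im; apply: compact_closed; first exact: metric_hausdorff.
  by have [] := DP i (leqW im).
have gB : geodesically_convex B.
  move=> p q g Bp Bq gg t t01 i im; have [_ gD _] := DP i (leqW im).
  exact: gD _ _ _ (Bp i im) (Bq i im) gg t t01.
have A0 : A !=set0 by have [p Dp] := Dj 0%N isT; exists p; exact: Dp.
have B0 : B !=set0.
  have [p Dp] := Dj m.+1 (leqnn _); exists p => i im; apply: Dp; first exact: leqW.
  by rewrite neq_ltn ltnS im.
have [a [b [Aa Bb minab]]] := compact_mdist_min2 A0 B0 cA cB.
have Qa := AQ _ Aa; have Qb := BQ _ Bb.
have ab0 : 0 < mdist a b ^+ 2.
  rewrite exprn_gt0 // mdist_gt0; apply/eqP => ab; apply: noD; exists a => i.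
  by rewrite leq_eqVlt => /predU1P[->//|im]; rewrite ab; exact: Bb.
(* Its zero set is the bisector. It is affine along geodesics of [Q], and [flat_projection] puts [A]
   and [B] strictly on opposite sides. *)
pose phi p := mdist p a ^+ 2 - mdist p b ^+ 2.
have phiA p : A p -> phi p < 0.
  move=> Ap; have := flat_projection fl AQ gA Aa Qb (fun q Aq => minab q b Aq Bb) Ap.
  by rewrite /phi (metric_sym a p) => ?; lra.
have phiB p : B p -> 0 < phi p.
  move=> Bp; have := @flat_projection Q B b a p fl BQ gB Bb Qa _ Bp.
  rewrite /phi (metric_sym b a) (metric_sym b p) => h.
  have {h}/h : forall q, B q -> mdist a b <= mdist q a.
    by move=> q Bq; rewrite (metric_sym q); exact: minab.
  by move=> ?; lra.
have phi_aff p q g t : Q p -> Q q -> geodesic p q g -> 0 <= t <= 1 ->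
    phi (g t) = (1 - t) * phi p + t * phi q.
  move=> Qp Qq gg t01; have [_ E] := fl _ _ _ Qp Qq gg t t01.
  by rewrite /phi !E //; ring.
have cross p q S : Q p -> Q q -> geodesically_convex S -> S p -> S q ->
    phi p < 0 -> 0 < phi q -> exists2 x, S x & phi x = 0.
  move=> Qp Qq cS Sp Sq p0 q0; have [geo _] := catX; have [g gg] := geo p q.
  have d0 : 0 < phi q - phi p by lra.
  pose t := - phi p / (phi q - phi p).
  have t01 : 0 <= t <= 1.
    by rewrite divr_ge0 ?ler_pdivrMr //=; lra.
  exists (g t); first exact: cS Sp Sq gg t t01.
  by rewrite (phi_aff _ _ _ _ Qp Qq gg t01) /t; field; rewrite gt_eqF.
have phic : continuous phi.
  move=> p; apply: cvgB;
    exact: (continuous_comp (@mdist_continuous _ p) (@exprn_continuous _ 2 _)).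
have closedH : closed [set p | phi p = 0].
  exact: (closed_comp (fun p _ => phic p) (@closed_eq _ 0)).
pose D' i := D i `&` [set p | phi p = 0].
have UQ i p : (i <= m.+1)%N -> D i p -> Q p by move=> im; have [_ _] := DP i im; apply.
have cvxH S : S `<=` Q -> geodesically_convex S ->
    geodesically_convex (S `&` [set p | phi p = 0]).
  move=> SQ cS p q g [Sp p0] [Sq q0] gg t t01; split; first exact: cS Sp Sq gg t t01.
  by rewrite /= (phi_aff _ _ _ _ (SQ _ Sp) (SQ _ Sq) gg t01) p0 q0; ring.
(* The last set is [A], which misses the bisector, so the other sets already cover the cut of the
   convex union. *)
have UE : [set p | exists2 i, (i <= m)%N & D' i p] =
    [set p | exists2 i, (i <= m.+1)%N & D i p] `&` [set p | phi p = 0].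
  apply/seteqP; split=> [p [i im [Dp p0]]|p [[i]]].
    by split=> //; exists i => //; exact: leqW.
  rewrite leq_eqVlt => /predU1P[-> /phiA|im Dp] /=; last by exists i.
  by move=> + p0; rewrite p0 ltxx.
have [||||p Dp] := IHm D'.
- move=> i im; have [cD gD DQ] := DP i (leqW im); split.
  + exact: compact_closedI.
  + exact: cvxH.
  + by move=> p [/DQ].
- by rewrite UE; apply: cvxH => // p [i im]; exact: UQ.
- have [||||x Ux x0] := cross a b _ Qa Qb Ucvx.
  + by exists m.+1.
  + by exists 0%N => //; exact: Bb.
  + exact: phiA.
  + exact: phiB.
  have : ([set p | exists2 i, (i <= m.+1)%N & D i p] `&` [set p | phi p = 0]) x by [].
  by rewrite -UE => -[i im Dx]; exists i => //; exists x.
(* [p] lies in [A] and [b] in [B], on opposite sides. Both belong to the convex set [S], which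
   therefore meets the bisector. *)
- move=> j jm; have [p Dp] := Dj j (leqW jm).
  have Ap : A p by apply: Dp => //; rewrite neq_ltn ltnS jm orbT.
  pose S := [set q | forall i, (i <= m)%N -> i != j -> D i q].
  have gS : geodesically_convex S.
    move=> q q' g Sq Sq' gg t t01 i im ij; have [_ gD _] := DP i (leqW im).
    exact: gD _ _ _ (Sq i im ij) (Sq' i im ij) gg t t01.
  have [||x Sx x0] := cross p b S (AQ _ Ap) Qb gS _ _ (phiA _ Ap) (phiB _ Bb).
  + by move=> i im; exact: Dp (leqW im).
  + by move=> i im _; exact: Bb.
  by exists x => i im ij; split=> //; exact: Sx.
have Bp : B p by move=> i /Dp[].
by have := phiB _ Bp; have [_ ->] := Dp 0%N isT; rewrite ltxx.
Qed.

End MetricSpace.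

Lemma fmap_ultra (T U : Type) (f : T -> U) (F : set_system T) :
  UltraFilter F -> UltraFilter (f @ F).
Proof.
move=> FU; have FP : ProperFilter F by exact: ultra_proper.
split; first exact: fmap_proper_filter.
move=> G GF sub; apply/seteqP; split=> // A GA.
have [//|FnA] := in_ultra_setVsetC (f @^-1` A) FU.
have GnA : G (~` A) by apply: sub.
exfalso; apply: (@filter_not_empty _ G GF); rewrite -(setICr A).
exact: filterI.
Qed.

(** * The Hopf-Rinow theorem: compactness of closed balls *)

Section HopfRinow.
Variables (R : realType) (X : metricType R).
Hypothesis X_complete : complete_space X.
Hypothesis X_geodesic : geodesic_space X.
Hypothesis X_locally_compact : forall p : X, exists2 K, compact K & nbhs p K.
Variable w : X.

Let B r := [set p : X | mdist p w <= r].

Let B_closed r : closed (B r).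
Proof.
exact: (closed_comp (fun p _ => @mdist_continuous R X w p) (@closed_le _ r)).
Qed.

(** [q] is the point where a geodesic from [w] to [p] crosses the sphere of radius [r]. *)
Let retract r p : 0 <= r -> r < mdist p w ->
  exists2 q, B r q & mdist p q = mdist p w - r.
Proof.
move=> r0 rp; have [g [g0 g1 gd]] := X_geodesic w p.
have d0 : 0 < mdist p w by exact: le_lt_trans rp.
pose t := r / mdist p w; have t0 : 0 <= t by rewrite divr_ge0 // ltW.
have t1 : t <= 1 by rewrite ler_pdivrMr // mul1r ltW.
have td : t * mdist p w = r by rewrite /t divfK // gt_eqF.
exists (g t).
  rewrite /B /= -[X in mdist _ X]g0 gd ?lexx ?ler01 ?t0 // subr0 ger0_norm //.
  by rewrite metric_sym td.
rewrite -[X in mdist X _]g1 gd ?lexx ?ler01 ?t0 // ger0_norm ?subr_ge0 //.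
by rewrite metric_sym mulrBl mul1r td.
Qed.

Let compact_le r r' : r <= r' -> compact (B r') -> compact (B r).
Proof.
by move=> rr' /(subclosed_compact (@B_closed r)); apply=> p /= /le_trans; apply.
Qed.

(** Moving points by less than [e / 2] sends an ultrafilter on [B s] into a compact ball [B r],
    where it converges. The ultrafilter is therefore Cauchy, and completeness gives its limit. *)
Let compact_left s : 0 <= s ->
  (forall e, 0 < e -> exists r, [/\ 0 <= r, s - e < r & compact (B r)]) ->
  compact (B s).
Proof.
move=> s0 approx; rewrite compact_ultra => F FU FB.
have FP : ProperFilter F by exact: ultra_proper.
have Fc : cauchy F.
  apply: cauchy_exP => e e0; have e20 : 0 < e / 2 by rewrite divr_gt0.
  have [r [r0 sr cr]] := approx _ e20.
  have /choice[f fP] : forall p, exists q, B s p -> B r q /\ mdist p q < e / 2.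
    move=> p; have [pr|rp] := leP (mdist p w) r.
      by exists p => _; rewrite mdistxx.
    have [q Bq pq] := retract r0 rp; exists q; rewrite /B /= => ps; split=> //.
    by rewrite pq; lra.
  move: cr; rewrite compact_ultra => /(_ _ (fmap_ultra f FU)) [].
    exact: (filterS (fun p Bp => (fP p Bp).1) FB).
  move=> q [_ fq]; exists q.
  have : (f @ F) (ball q (e / 2)) by apply: fq; exact: nbhsx_ballx.
  move=> /= Fq; apply: filterS (filterI Fq FB) => p [].
  rewrite /= !ballEmdist /= => qf /fP[_ pf].
  by have := metric_triangle q (f p) p; rewrite (metric_sym (f p) p); lra.
have [l Fl] := X_complete FP Fc.
exists l; split=> //; apply: B_closed => U Ul.
exact: (filter_ex (filterI FB (Fl U Ul))).
Qed.

(** Some compact [K] contains all points within a fixed distance of [B s]; by [retract], a slightly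
    larger ball stays within that distance. *)
Let compact_right s : 0 <= s -> compact (B s) ->
  exists2 e, 0 < e & compact (B (s + e)).
Proof.
move=> s0 cB; have ncB : near_covering (B s) by apply/compact_near_coveringP.
(* Compact sets directed by inclusion: with this filter, [near_covering] yields one compact
   neighbourhood of all of [B s], as a finite subcover would. *)
pose G := filter_from (@compact X) (fun K => [set K' | compact K' /\ K `<=` K']).
have GF : Filter G.
  apply: filter_from_filter; first by exists set0; exact: compact0.
  move=> K1 K2 c1 c2; exists (K1 `|` K2); first exact: compactU.
  move=> K [cK sub]; split; split=> //; apply: subset_trans sub.
    exact: subsetUl.
  exact: subsetUr.
have [K cK [_ BK]] : exists2 K, compact K & compact K /\ forall p, B s p -> nbhs p K.
  have : \forall K \near G, B s `<=` (fun p => compact K /\ nbhs p K).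
    apply: ncB => p _; have [K cK Kp] := X_locally_compact p.
    have intK : nbhs p (interior K) by apply: nbhs_interior.
    exists (interior K, [set K' | compact K' /\ K `<=` K']).
      by split=> //; exists K.
    move=> [q K'] [/= Kq [cK' KK']]; split=> //.
    exact: filterS KK' Kq.
  move=> [K cK sub]; exists K => //; split=> // p Bp.
  by have [] := sub K (conj cK (@subset_refl _ K)) p Bp.
have : \forall e \near 0^'+, B s `<=` (fun p => ball p e `<=` K).
  apply: ncB => p /BK /nbhs_ballP[r /= r0 rK].
  exists (ball p (r / 2), [set e | e < r / 2]).
    split; first by apply: nbhsx_ballx; rewrite divr_gt0.
    by apply: nbhs_right_lt; rewrite divr_gt0.
  move=> [q e] [/= pq er] z qz; apply: rK.
  by rewrite (splitr r); apply: ball_triangle pq _; apply: le_ball qz; exact: ltW.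
move=> nearK.
have [e [e0 eK]] : exists e, 0 < e /\ B s `<=` (fun p => ball p e `<=` K).
  near (0:R)^'+ => e; exists e; split; first by near: e; exact: nbhs_right_gt.
  by near: e.
exists (e / 2); first by rewrite divr_gt0.
apply: subclosed_compact cK _; first exact: B_closed.
move=> p; rewrite /B /= => ps; have [p's|sp] := leP (mdist p w) s.
  exact: nbhs_singleton (BK _ p's).
have [q Bq pq] := retract s0 sp; apply: (eK q) => //.
by rewrite ballEmdist /= metric_sym pq; lra.
Unshelve. all: by end_near. Qed.

(** If a ball of nonnegative radius were not compact, the supremum of the radii of compact balls
    would be attained by [compact_left] and exceeded by [compact_right]. *)
Lemma closed_mdist_ball_compact r : compact [set p : X | mdist p w <= r].
Proof.
rewrite -/(B r).
have [r0|r0] := ltP r 0.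
  have -> : B r = set0; last exact: compact0.
  rewrite -subset0 => p; rewrite /B /= => pr.
  by have := le_trans (mdist_ge0 p w) pr; rewrite leNgt r0.
apply: contrapT => ncr.
pose S := [set s | 0 <= s /\ compact (B s)].
have Sr : ubound S r.
  by move=> s [_ cs]; rewrite leNgt; apply/negP => /ltW /compact_le /(_ cs).
have S0 : S 0.
  split=> //; have -> : B 0 = [set w]; last exact: compact_set1.
  apply/seteqP; split=> [p|p ->]; last by rewrite /B /= mdistxx.
  rewrite /B /= => p0; apply: mdist_positivity; apply/le_anti.
  by rewrite p0 mdist_ge0.
have hS : has_sup S by split; [exists 0|exists r].
have s0 : 0 <= sup S by exact: sup_upper_bound.
have cs : compact (B (sup S)).
  apply: compact_left => // e e0; have [q [q0 cq] lt] := sup_adherent e0 hS.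
  by exists q.
have [e e0 ce] := compact_right s0 cs.
have /(sup_upper_bound hS) : S (sup S + e) by split=> //; rewrite addr_ge0 // ltW.
by rewrite gerDl leNgt e0.
Qed.

End HopfRinow.

(** * Carriers and stars *)

(** The sets whose union with [s] is a face form a complex containing all faces above [s], so
    minimality gives one direction. For the other, [t] is a face of such a union. *)
Lemma starE (V : choiceType) (C : set {fset V}) s t : simplicial_complex C ->
  t != fset0 -> star s C t <-> C (s `|` t)%fset.
Proof.
move=> [C0 Csub] t0; split=> [st|Cst].
  have [] // := st [set u | u != fset0 /\ C (s `|` u)%fset].
  split=> [|u [Cu su]].
    split=> [u [u0 _]//|u v [u0 Cu] vu v0]; split=> //.
    apply: Csub Cu _ _; first exact: fsetUS.
    by apply: contra_neq v0 => /eqP; rewrite fsetU_eq0 => /andP[_ /eqP].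
  by split; [exact: C0|rewrite (fsetUidPr _ _ su)].
move=> M [[_ Msub] sM]; apply: Msub (fsubsetUr s t) t0.
by apply: sM; split=> //; exact: fsubsetUl.
Qed.

Section Carrier.
Variables (R : realType) (V : choiceType) (C : set {fset V}).
Variables (X : topologicalType) (h : (V -> R) -> X).
Hypothesis C_cplx : simplicial_complex C.
Hypothesis h_homeo : realization_homeo C h.

(** The default [fun=> 0] is never reached, because [h] maps the realization onto [X]. *)
Definition coords (p : X) : V -> R :=
  xget (fun=> 0) [set x | realization C x /\ h x = p].

Lemma coordsP p : realization C (coords p) /\ h (coords p) = p.
Proof.
rewrite /coords; have [[_ _ surj] _] := h_homeo.
by have [x Cx hx] := surj p I; apply: (@xgetPex _ (fun=> 0) [set x | realization C x /\ h x = p]); exists x.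
Qed.

Lemma hK x : realization C x -> coords (h x) = x.
Proof.
move=> Cx; have [[_ inj _] _] := h_homeo; have [Cc hc] := coordsP (h x).
by apply: inj => //; rewrite inE.
Qed.

Definition carrier p : {fset V} := fset_set [set v | coords p v != 0].

Lemma in_carrier p v : (v \in carrier p) = (coords p v != 0).
Proof.
have [[s Cs [_ out _]] _] := coordsP p.
have fin : finite_set [set u | coords p u != 0].
  apply: sub_finite_set (finite_fset s) => u /=.
  by apply: contraNT => us; rewrite out.
by rewrite in_fset_set //; apply/idP/idP; rewrite inE.
Qed.

Lemma coords_ge0 p v : 0 <= coords p v.
Proof. by have [[s _ []]] := coordsP p. Qed.

Lemma carrierP s p : C s -> (h @` cell s) p <-> (carrier p `<=` s)%fset.
Proof.
move=> Cs; split=> [[x sx <-]|sub].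
  apply/fsubsetP => v; rewrite in_carrier hK; last by exists s.
  by have [_ out _] := sx; apply: contraNT => /out ->.
have [[t Ct [ge0 out sum1]] hp] := coordsP p.
exists (coords p) => //; split=> // [v vs|].
  apply/eqP; rewrite -[_ == _]negbK -in_carrier.
  by apply: contra vs; exact: (fsubsetP sub).
rewrite -sum1 -(big_fset_incl _ sub) /=.
  apply: big_fset_incl => [|v _]; last by rewrite in_carrier negbK => /eqP.
  by apply/fsubsetP => v; rewrite in_carrier; apply: contraNT => /out ->.
by move=> v _; rewrite in_carrier negbK => /eqP.
Qed.

Lemma carrier_face p : C (carrier p).
Proof.
have [[s Cs sx] hp] := coordsP p.
have sub : (carrier p `<=` s)%fset by apply/(carrierP _ Cs); exists (coords p).
apply: C_cplx.2 Cs sub _; apply/eqP => E; have [_ _ sum1] := sx.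
have : \sum_(v <- s) coords p v = 0.
  rewrite big1 // => v _; apply/eqP; rewrite -[_ == _]negbK -in_carrier E.
  by rewrite in_fset0.
by rewrite sum1 => /eqP; rewrite oner_eq0.
Qed.

Lemma carrier_neq0 p : exists v, v \in carrier p.
Proof. by apply/fset0Pn; apply: C_cplx.1; exact: carrier_face. Qed.

Lemma vertex_point v : C [fset v]%fset -> exists p, carrier p = [fset v]%fset.
Proof.
move=> Cv; pose x u : R := (u == v)%:R.
have cx : cell [fset v]%fset x.
  split=> [u|u|]; first exact: ler0n.
    by rewrite inE /x => /negPf ->.
  by rewrite big_seq_fset1 /x eqxx.
exists (h x); have : (carrier (h x) `<=` [fset v])%fset.
  by apply/(carrierP _ Cv); exists x.
rewrite fsubset1 => /orP[/eqP//|/eqP E].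
by have := C_cplx.1 _ (carrier_face (h x)); rewrite E eqxx.
Qed.

Lemma star_realizationE v p : C [fset v]%fset ->
  (h @` realization (star [fset v]%fset C)) p <-> C (v |` carrier p)%fset.
Proof.
have [C0 Csub] := C_cplx; have c0 := C0 _ (carrier_face p).
move=> Cv; split=> [[x [t st tx] hx]|Cc].
  have t0 : t != fset0.
    apply/eqP => t0; have [_ _] := tx; rewrite t0 big_seq_fset0 => /eqP.
    by rewrite eq_sym oner_eq0.
  have Ct := (starE [fset v]%fset C_cplx t0).1 st.
  have sub : (carrier p `<=` t)%fset.
    apply/carrierP; first exact: Csub Ct (fsubsetUr _ _) t0.
    by exists x.
  apply: Csub Ct _ _; first exact: fsetUS.
  by apply/fset0Pn; exists v; rewrite fset1U1.
have [hx] := (carrierP p (carrier_face p)).2 (fsubset_refl _).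
move=> chx hp; exists hx => //; exists (carrier p) => //.
exact/starE.
Qed.

Lemma carrier_open v : open [set p | v \in carrier p].
Proof.
apply/(h_homeo.2 _) => s Cs x sx /=; rewrite in_carrier hK; last by exists s.
move=> xv; have x0 : 0 < x v by rewrite lt_neqAle eq_sym xv; case: sx => ->.
exists (x v) => // y sy /(_ v) xyv; rewrite in_carrier hK; last by exists s.
by apply: contraTneq xyv => ->; rewrite subr0 gtr0_norm // ltxx.
Qed.

Lemma near_carrier p : \forall q \near p, (carrier p `<=` carrier q)%fset.
Proof.
have : nbhs p (\bigcap_(v in [set` carrier p]) [set q | v \in carrier q]).
  apply: filter_bigI => v vp; apply: open_nbhs_nbhs; split=> //.
  exact: carrier_open.
by apply: filterS => q sub; apply/fsubsetP => v /sub.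
Qed.

(** Carriers only grow near a point, and nonempty subsets of faces are faces; so the complement is
    open. *)
Lemma carrier_closed s : closed [set p | C (carrier p `|` s)%fset].
Proof.
rewrite -openC openE => p nCp; apply: filterS (near_carrier p) => q sub Cq.
apply: nCp; apply: C_cplx.2 Cq _ _; first exact: fsetSU.
have [v vp] := carrier_neq0 p; apply/fset0Pn; exists v.
by rewrite inE vp.
Qed.

(** Along an ultrafilter on the cell every coordinate converges in the unit interval, and the limits
    are the coordinates of a point of the cell. Only the finitely many coordinates in [s] matter for
    convergence in the coherent topology. *)
Lemma cell_compact s : C s -> compact (h @` cell s).
Proof.
move=> Cs; rewrite compact_ultra => F FU Fs.
have FP : ProperFilter F by exact: ultra_proper.
have cellP p : (h @` cell s) p -> cell s (coords p).
  by move=> [x sx <-]; rewrite hK //; exists s.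
have /choice[x xP] : forall v, exists l : R, (fun p => coords p v) @ F --> l.
  move=> v.
  have c01 p : (h @` cell s) p -> `[0, 1]%classic (coords p v).
    move=> /cellP[ge0 out sum1]; rewrite /= in_itv /= ge0 /=.
    have [vs|/out ->] := boolP (v \in s); last exact: ler01.
    by rewrite -sum1 (big_fsetD1 v) //= lerDl sumr_ge0.
  have := @segment_compact R 0 1.
  rewrite compact_ultra => /(_ _ (fmap_ultra (fun p => coords p v) FU)) [].
    exact: (filterS c01 Fs).
  by move=> l [_ fl]; exists l.
have sumF (r : seq V) : (fun p => \sum_(v <- r) coords p v) @ F --> \sum_(v <- r) x v.
  elim: r => [|v r IHr].
    rewrite big_nil; under eq_fun do rewrite big_nil; exact: cvg_cst.
  rewrite big_cons; under eq_fun do rewrite big_cons; exact: cvgD.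
have lim_eq (f : X -> R) (l c : R) : f @ F --> l ->
    (forall p, (h @` cell s) p -> f p = c) -> l = c.
  move=> fl fc; apply: (cvg_unique (@Rhausdorff R) fl); apply: cvg_near_cst.
  exact: (filterS fc Fs).
have xs : cell s x.
  split=> [v|v vs|]; last by apply: lim_eq (sumF s) _ => p /cellP[].
    by apply: (cvgr_to_ge (xP v)); apply: nearW => p; exact: coords_ge0.
  by apply: lim_eq (xP v) _ => p /cellP[_ out _]; exact: out.
exists (h x); split; first by exists x.
move=> U; rewrite nbhsE => -[W [Wo Wx] WU]; apply: filterS WU _.
have [e e0 eW] := (h_homeo.2 W).1 Wo s Cs x xs Wx.
have close : F (\bigcap_(v in [set` s]) [set p | `|x v - coords p v| < e]).
  by apply: filter_bigI => v _; have /cvgrPdist_lt := xP v; exact.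
apply: filterS (filterI Fs close) => p [sp cp].
rewrite -(coordsP p).2; apply: eW; first exact: cellP.
move=> v; have [/cp//|vs] := boolP (v \in s).
have [_ out _] := cellP _ sp; have [_ out' _] := xs.
by rewrite out // out' // subrr normr0.
Qed.

End Carrier.

(** * Polyhedral complexes with convex vertex stars *)

Section ConvexStars.
Variables (R : realType) (V : choiceType) (C : set {fset V}).
Variables (X : metricType R) (h : (V -> R) -> X).
Hypothesis C_cplx : simplicial_complex C.
Hypothesis C_lf : locally_finite C.
Hypothesis h_homeo : realization_homeo C h.
Hypothesis catX : CAT0 X.
Hypothesis h_poly : polyhedral C h.
Hypothesis h_stars : convex_vertex_stars C h.

Local Notation carrier := (carrier C h).

Let C_sub := C_cplx.2.

Lemma cell_flat s : C s -> flat (h @` cell s).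
Proof. by move=> /h_poly[m [n [p]]]; exact: flat_polytope. Qed.

Lemma vertex_star_convex v : C [fset v]%fset ->
  geodesically_convex [set p | C (v |` carrier p)%fset].
Proof.
move=> Cv p q g Cp Cq gg t t01; apply/(star_realizationE C_cplx h_homeo) => //.
by apply: (h_stars Cv _ _ gg) => //; apply/(star_realizationE C_cplx h_homeo).
Qed.

(* If the join of s and v were missing, the star of v would meet the cell s
   exactly in its boundary, which would thus be convex. The facets of s would
   then contradict Berge's theorem. *)
Lemma cone_face s v : C s -> (1 < #|` s|)%N -> C [fset v]%fset ->
  (forall i, i \in s -> C (v |` (s `\ i))%fset) -> C (v |` s)%fset.
Proof.
move=> Cs card_s Cv bd; apply: contrapT => nC.
(* The vertices of [s] are numbered from 0 to [m]; the default [v] is not reached for these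
   indices. *)
pose e i := nth v s i; pose m := #|` s|.-1.
have mS : #|` s| = m.+1 by rewrite /m prednK // ltnW.
have es i : (i <= m)%N -> e i \in s by move=> im; rewrite mem_nth // -/#|` s| mS.
have e_onto a : a \in s -> exists2 i, (i <= m)%N & a = e i.
  move=> sa; exists (index a s); last by rewrite /e nth_index.
  by rewrite -ltnS -mS index_mem.
have e_inj i j : (i <= m)%N -> (j <= m)%N -> i != j -> e i != e j.
  by move=> im jm; rewrite /e nth_uniq // -/#|` s| mS.
have facet i : (i <= m)%N -> C (s `\ e i)%fset.
  move=> im; apply: C_sub Cs (fsubsetDl _ _) _.
  by move: card_s; rewrite (cardfsD1 (e i)) es // add1n ltnS cardfs_gt0.
pose D i := h @` cell (s `\ e i)%fset.
have DE i p : (i <= m)%N -> D i p <-> (carrier p `<=` s `\ e i)%fset.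
  by move=> im; apply: carrierP => //; exact: facet.
have UE p : (exists2 i, (i <= m)%N & D i p) <->
    (h @` cell s) p /\ C (v |` carrier p)%fset.
  split=> [[i im /(DE _ _ im) sub]|[/(carrierP h_homeo _ Cs) sub Cp]].
    split; first by apply/(carrierP h_homeo _ Cs); apply: fsubset_trans sub (fsubsetDl _ _).
    apply: C_sub (bd _ (es i im)) (fsetUS _ sub) _.
    by apply/fset0Pn; exists v; rewrite fset1U1.
  have : ~~ (s `<=` carrier p)%fset.
    apply/negP => sub'; apply: nC.
    have -> : s = carrier p by apply/eqP; rewrite eqEfsubset sub' sub.
    by [].
  move=> /fsubsetPn[a /e_onto[i im ->] ap]; exists i => //; apply/DE => //.
  by rewrite fsubsetD1 sub ap.
(* A vertex of [s] lies in every facet but the opposite one, which is how all facets but one have a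
   common point. *)
have vert i j : (i <= m)%N -> (j <= m)%N -> i != j -> forall p,
    carrier p = [fset e i]%fset -> D j p.
  move=> im jm ij p pE; apply/DE => //.
  by rewrite pE fsub1set !inE es // andbT e_inj.
have vpt i : (i <= m)%N -> exists p, carrier p = [fset e i]%fset.
  move=> im; apply: vertex_point => //; apply: C_sub Cs _ _.
    by rewrite fsub1set es.
  by apply/fset0Pn; exists (e i); rewrite inE.
have [||||p Dp] := @compact_convex_bigcap_neq0 R X catX _ m D (cell_flat Cs).
- move=> i im; split.
  + exact: (cell_compact h_homeo (facet i im)).
  + by apply: flat_convex; apply: cell_flat; exact: facet.
  + move=> p /(DE _ _ im) sub; apply/(carrierP h_homeo _ Cs).
    exact: fsubset_trans sub (fsubsetDl _ _).
- move=> p q g /UE[sp Cp] /UE[sq Cq] gg t t01; apply/UE; split.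
    exact: (flat_convex (cell_flat Cs) sp sq gg).
  exact: (vertex_star_convex Cv Cp Cq gg).
- have m0 : (0 < m)%N by rewrite -ltnS -mS.
  by have [p pE] := vpt 0%N isT; exists m => //; exists p; apply: (vert 0%N); rewrite // neq_ltn m0.
- move=> j jm; have [p pE] := vpt j jm; exists p => i im ij.
  by apply: (vert j) => //; rewrite eq_sym.
(* The carrier of a common point contains some vertex [e i] of [s], but the facet [D i] omits it. *)
have [a ap] := carrier_neq0 C_cplx h_homeo p.
have as_ : a \in s.
  have /(DE _ _ (isT : (0 <= m)%N)) sub := Dp 0%N isT.
  by have := fsubsetP sub _ ap; rewrite inE => /andP[].
have [i im aE] := e_onto a as_.
have /(DE _ _ im)/fsubsetP/(_ _ ap) := Dp i im.
by rewrite aE !inE eqxx.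
Qed.

(** A vertex [v] is removed from [s]. Induction makes the rest, and the cone from [v] over each of
    its facets, faces; [cone_face] then restores [v]. When the rest is a single vertex, [s] is one
    of the given pairs. *)
Lemma flag_complex s : s != fset0 ->
  (forall a b, a \in s -> b \in s -> C [fset a; b]%fset) -> C s.
Proof.
elim: {s}_.+1 {-2}s (ltnSn #|` s|) => // n IHn s; rewrite ltnS => card_s s0 pairs.
have /fset0Pn[v vs] := s0.
have Cv : C [fset v]%fset by rewrite -[[fset v]%fset]fsetUid; exact: pairs.
have sE := fsetD1K vs.
have [t0|t0] := eqVneq (s `\ v)%fset fset0.
  by rewrite -sE t0 fsetU0.
have card_t : (#|` (s `\ v)%fset| < n)%N.
  by apply: leq_trans card_s; rewrite (cardfsD1 v s) vs.
have ts a : a \in (s `\ v)%fset -> a \in s by rewrite inE => /andP[].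
have Ct : C (s `\ v)%fset.
  by apply: IHn => // a b /ts sa /ts sb; exact: pairs.
rewrite -sE; have [card1|card1] := leqP #|` (s `\ v)%fset| 1.
  have /eqP/cardfs1P[a tE] : #|` (s `\ v)%fset| = 1%N.
    by apply/eqP; rewrite eqn_leq card1 cardfs_gt0.
  by rewrite tE; apply: pairs => //; apply: ts; rewrite tE inE.
apply: cone_face => // i it; apply: IHn.
- apply: leq_trans card_s; rewrite (cardfsD1 i s) (ts _ it) add1n ltnS.
  apply: fsubset_leq_card; apply/fsubsetP => a; rewrite !inE.
  move: it; rewrite !inE => /andP[iv _] /orP[/eqP->|/and3P[-> _ ->]] //.
  by rewrite eq_sym iv.
- by apply/fset0Pn; exists v; rewrite fset1U1.
have sub a : a \in (v |` ((s `\ v) `\ i))%fset -> a \in s.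
  by rewrite !inE => /orP[/eqP->//|/and3P[]].
by move=> a b /sub sa /sub sb; exact: pairs.
Qed.

Local Notation S s := [set p : X | C (carrier p `|` s)%fset].

(** From right to left, [flag_complex] leaves only pairs to check; one with a vertex in [s] and one
    in the carrier comes from a vertex star. *)
Lemma face_starE s p : C s ->
  C (carrier p `|` s)%fset <-> forall v, v \in s -> C (v |` carrier p)%fset.
Proof.
move=> Cs; have Cp := carrier_face C_cplx h_homeo p.
have ne (u : {fset V}) a : a \in u -> u != fset0 by move=> au; apply/fset0Pn; exists a.
split=> [Cps v vs|Cv].
  apply: C_sub Cps _ (ne _ v _); last exact: fset1U1.
  by rewrite fsetUC; apply: fsetUS; rewrite fsub1set.
have [a ap] := carrier_neq0 C_cplx h_homeo p.
have pair (t : {fset V}) b c : C t -> b \in t -> c \in t -> C [fset b; c]%fset.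
  move=> Ct bt ct; apply: C_sub Ct _ (ne _ b _); last by rewrite !inE eqxx.
  by apply/fsubsetP => d; rewrite !inE => /orP[] /eqP->.
apply: flag_complex => [|b c].
  by apply: (ne _ a); rewrite inE ap.
rewrite !inE => /orP[bp|bs] /orP[cp|cs].
- exact: pair Cp bp cp.
- by apply: pair (Cv _ cs) _ _; rewrite !inE ?bp ?eqxx ?orbT.
- by apply: pair (Cv _ bs) _ _; rewrite !inE ?cp ?eqxx ?orbT.
- exact: pair Cs bs cs.
Qed.

Lemma vertex_face s v : C s -> v \in s -> C [fset v]%fset.
Proof.
move=> Cs vs; apply: C_sub Cs _ _; first by rewrite fsub1set.
by apply/fset0Pn; exists v; rewrite inE.
Qed.

Lemma face_star_convex s : C s -> geodesically_convex (S s).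
Proof.
move=> Cs p q g /(face_starE _ Cs) Sp /(face_starE _ Cs) Sq gg t t01.
apply/(face_starE _ Cs) => v vs.
exact: (vertex_star_convex (vertex_face Cs vs) (Sp v vs) (Sq v vs) gg).
Qed.

(** By local finiteness, a finite union of closed cells. It serves both for the compactness of stars
    and for local compactness. *)
Lemma vertex_star_cover v : exists2 K, compact K &
  forall p (t : {fset V}), C t -> (carrier p `<=` t)%fset -> v \in t -> K p.
Proof.
have fin := C_lf v.
exists (\big[setU/set0]_(t <- fset_set [set t | C t /\ v \in t]) (h @` cell t)).
  rewrite big_seq; apply: bigsetU_compact => t; rewrite in_fset_set // inE => -[Ct _].
  exact: (cell_compact h_homeo Ct).
move=> p t Ct sub vt; rewrite bigsetU_fset_set //; exists t => //.
exact/(carrierP h_homeo).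
Qed.

Lemma face_star_compact s : C s -> compact (S s).
Proof.
move=> Cs; have /fset0Pn[v vs] := C_cplx.1 _ Cs.
have [K cK sub] := vertex_star_cover v.
apply: subclosed_compact cK _; first exact: carrier_closed.
by move=> p Cp; apply: sub Cp (fsubsetUl _ _) _; rewrite inE vs orbT.
Qed.

Lemma face_star_neq0 s : C s -> S s !=set0.
Proof.
move=> Cs; have /fset0Pn[v vs] := C_cplx.1 _ Cs.
have [p pE] := vertex_point C_cplx h_homeo (vertex_face Cs vs).
by exists p; rewrite /= pE (fsetUidPr _ _ _) // fsub1set.
Qed.

Lemma polyhedron_locally_compact (p : X) : exists2 K, compact K & nbhs p K.
Proof.
have [v vp] := carrier_neq0 C_cplx h_homeo p.
have [K cK sub] := vertex_star_cover v; exists K => //.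
apply: filterS (near_carrier h_homeo p) => q pq.
apply: (sub q (carrier q)) => //; first exact: carrier_face.
exact: (fsubsetP pq).
Qed.

(** Finitely many open vertex stars cover [A], and each [s] counted lies in a face with one of these
    vertices; local finiteness leaves finitely many such faces. *)
Lemma compact_finite_star (A : set X) : compact A ->
  finite_set [set s | C s /\ exists2 p, A p & C (carrier p `|` s)%fset].
Proof.
move=> cA; have ncA : near_covering A by apply/compact_near_coveringP.
pose G : set_system {fset V} :=
  filter_from setT (fun F => [set F' | (F `<=` F')%fset]).
have GF : Filter G.
  apply: filter_from_filter; first by exists fset0.
  move=> F1 F2 _ _; exists (F1 `|` F2)%fset => // F /=; rewrite fsubUset.
  by move=> /andP[].
have : \forall F \near G, A `<=` (fun p => exists2 v, v \in F & v \in carrier p).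
  apply: ncA => p _; have [v vp] := carrier_neq0 C_cplx h_homeo p.
  exists ([set q | v \in carrier q], [set F | ([fset v] `<=` F)%fset]).
    split; last by exists [fset v]%fset.
    by apply: open_nbhs_nbhs; split=> //; exact: carrier_open.
  by move=> [q F] [/= vq]; rewrite fsub1set => vF; exists v.
move=> [F _ /(_ F (fsubset_refl _)) cover].
apply: (@sub_finite_set _ _ (\bigcup_(v in [set` F])
   \bigcup_(t in [set t | C t /\ v \in t]) [set` fpowerset t])).
  move=> s [Cs [p Ap Cps]]; have [v vF vp] := cover _ Ap.
  exists v => //; exists (carrier p `|` s)%fset; first by rewrite /= inE vp.
  by rewrite /= fpowersetE fsubsetUr.
apply: bigcup_finite => // v _; apply: bigcup_finite => [|t _]; first exact: C_lf.
exact: finite_fset.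
Qed.

End ConvexStars.

(** * The matching given by nearest points to a base vertex *)

Theorem theorem1 (R : realType) (V : choiceType) (C : set {fset V})
    (X : metricType R) (h : (V -> R) -> X) :
  simplicial_complex C -> C !=set0 -> locally_finite C ->
  realization_homeo C h ->
  complete_space X -> CAT0 X ->
  polyhedral C h -> finitely_many_shapes C h ->
  convex_vertex_stars C h ->
  arborescent C.
Proof.
move=> C_cplx [s0 Cs0] C_lf h_homeo X_complete catX h_poly _ h_stars.
have C_sub := C_cplx.2; have [X_geo _] := catX.
pose car : X -> {fset V} := carrier C h.
pose S s := [set p : X | C (car p `|` s)%fset].
have Scvx s : C s -> geodesically_convex (S s) by exact: face_star_convex.
have /fset0Pn[v0 v0s] := C_cplx.1 _ Cs0.
have Cv0 := vertex_face C_cplx Cs0 v0s.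
have [w wE] := vertex_point C_cplx h_homeo Cv0; rewrite -/(car w) in wE.
have /choice[x xP] : forall s, exists p, C s ->
    S s p /\ forall q, S s q -> mdist p w <= mdist q w.
  move=> s; have [Cs|nCs] := pselect (C s); last by exists w => /nCs.
  have cS : compact (S s) by exact: face_star_compact.
  have [c Sc minc] := compact_mdist_min w (face_star_neq0 C_cplx h_homeo Cs) cS.
  by exists c.
have /choice[vtx vtxP] := carrier_neq0 C_cplx h_homeo.
pose m s := mdist (x s) w; pose y s := vtx (x s).
have S_mono s t : C t -> s != fset0 -> (s `<=` t)%fset -> C s /\ S t `<=` S s.
  move=> Ct sn0 st; split=> [|p Sp]; first exact: C_sub Ct st sn0.
  apply: C_sub Sp (fsetUS _ st) _.
  by have [v vs] := fset0Pn _ sn0; apply/fset0Pn; exists v; rewrite inE vs orbT.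
have m_mono s t : C t -> s != fset0 -> (s `<=` t)%fset ->
    m s <= m t /\ (m s = m t -> x s = x t).
  move=> Ct sn0 st; have [Cs sub] := S_mono _ _ Ct sn0 st.
  have [Ss mins] := xP s Cs; have [/sub St _] := xP t Ct.
  split=> [|E]; first exact: mins.
  exact: (mdist_min_unique catX (Scvx _ Cs) Ss St mins).
(* Convexity makes a local minimum of the distance to w on A a global one. *)
have local_min s A q : C s -> geodesically_convex A -> A (x s) -> A q ->
    (forall p, A p -> (car (x s) `<=` car p)%fset -> S s p) -> m s <= mdist q w.
  move=> Cs cA Ax Aq AS; rewrite leNgt; apply/negP => lt_q.
  have [g gg] := X_geo (x s) q.
  (* A short way along the geodesic, carriers still contain that of [x s], so the assumption on [A]
     applies there. *)
  have [t t01 sub] := geodesic_near gg (near_carrier h_homeo (x s)).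
  have t01' : 0 <= t <= 1 by case/andP: t01 => /ltW -> ->.
  have := (xP s Cs).2 _ (AS _ (cA _ _ _ Ax Aq gg t t01') sub).
  by rewrite leNgt (mdist_geodesic_lt catX gg t01 lt_q).
have yx s : y s \in car (x s) by exact: vtxP.
have xv0 s : C s -> S s w -> x s = w.
  move=> Cs Sw; have [_ /(_ _ Sw)] := xP s Cs; rewrite mdistxx => le0.
  by apply: mdist_positivity; apply/le_anti; rewrite le0 mdist_ge0.
have xv0' : x [fset v0]%fset = w.
  by apply: xv0 => //; rewrite /S /= wE fsetUid.
apply: (@arborescent_matching R V C m y v0) => //.
- move=> s t Ct sn0 st; have [le_st E] := m_mono s t Ct sn0 st.
  by split=> // /E; rewrite /y => ->.
- move=> s Cs; have [Sx _] := xP s Cs.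
  have sub : (y s |` s `<=` car (x s) `|` s)%fset.
    by rewrite fsubUset fsubsetUr andbT fsub1set inE yx.
  have ne : (y s |` s)%fset != fset0 by apply/fset0Pn; exists (y s); rewrite fset1U1.
  have Cys : C (y s |` s)%fset by exact: C_sub Sx sub ne.
  (* The carrier of [x s] contains [y s], so [x s] is still in the star after [y s] is joined to
     [s]. *)
  split=> //; apply/le_anti; apply/andP; split.
    have [_ /(_ (x s))] := xP _ Cys; apply.
    by rewrite /S /= fsetUA [(_ `|` [fset _])%fset](fsetUidPl _ _ _) // fsub1set.
  exact: (m_mono _ _ Cys (C_cplx.1 _ Cs) (fsubsetUr _ _)).1.
- move=> s Cs ys sy; have ne : (s `\ y s)%fset != fset0.
    by apply: contraNneq sy => E; rewrite -[X in X == _](fsetD1K ys) E fsetU0.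
  have sub := fsubsetDl s [fset y s]%fset.
  have [Cd Sd] := S_mono _ _ Cs ne sub.
  have [Sx _] := xP s Cs; have [Sxd _] := xP _ Cd.
  apply/le_anti; rewrite (m_mono _ _ Cs ne sub).1 /=.
  (* Points near [x s] have [y s] in their carrier; for them it makes no difference whether [y s] is
     also in the face. *)
  apply: (local_min s _ _ Cs (Scvx _ Cd) (Sd _ Sx) Sxd) => p Sp sub_p.
  have yp : y s \in car p by exact: (fsubsetP sub_p).
  rewrite /S /=; suff -> : (car p `|` s = car p `|` (s `\ y s))%fset by [].
  by rewrite -[in LHS](fsetD1K ys) fsetUA [(_ `|` [fset _])%fset](fsetUidPl _ _ _) // fsub1set.
- by rewrite /y xv0'; have := vtxP w; rewrite -/(car w) wE inE => /eqP.
- move=> s Cs sE.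
  (* The star of the single vertex [y s] is a neighbourhood of [x s], so [x s] minimizes the
     distance over the whole space and equals [w], whose carrier is [[fset v0]]. *)
  have : mdist (x s) w <= mdist w w.
    apply: (local_min s setT) => // p _ /fsubsetP/(_ _ (yx s)) yp.
    rewrite /S /= sE [(_ `|` [fset _])%fset](fsetUidPl _ _ _) ?fsub1set //.
    exact: carrier_face.
  rewrite mdistxx => le0; have xw : x s = w.
    by apply: mdist_positivity; apply/le_anti; rewrite le0 mdist_ge0.
  by have := yx s; rewrite xw wE inE => /eqP <-.
- move=> r; have cB : compact [set p : X | mdist p w <= r%:R].
    apply: closed_mdist_ball_compact => //.
    exact: polyhedron_locally_compact C_cplx C_lf h_homeo.
  apply: sub_finite_set (compact_finite_star C_cplx C_lf h_homeo cB).
  by move=> s [Cs ms]; split=> //; exists (x s) => //; have [] := xP s Cs.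
- by rewrite /m xv0' mdistxx.
Qed.
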